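(* Let $\mathscr{A}$ be a category with finite limits and let $\mathscr{P}$ be a projective class in $\mathscr{A}$. Let $X\xrightarrow{\partial}A$ be a $\mathscr{P}$-projective augmented precubical object and let $X'\xrightarrow{\partial'}A'$ be a $\mathscr{P}$-exact augmented precubical object in $\mathscr{A}$. Then any $\mathscr{A}$-morphism $f: A\to A'$ can be extended to a precubical morphism $\overline f=(f_n: X_n\to X'_n)_{n\ge 0}: X\to X'$ over $f$ (i.e., $\overline f$ and $f$ form a morphism of augmented precubical objects). Furthermore, any two such extensions are precubically homotopic. That is, if $\overline f=(f_n),\overline g=(g_n): X\to X'$ are two extensions of $f$, then there exist $\mathscr{A}$-morphisms $h_n: X_n\to X'_{n+1}$, $n\ge0$, such that $$\partial_1^0h_n=f_n,\quad \partial_1^1h_n=g_n,\quad n\ge0,$$ $$\partial_i^\varepsilon h_n=h_{n-1}\partial_{i-1}^\varepsilon,\quad n\ge1,\ 1<i\le n+1,\ \varepsilon\in\{0,1\}.$$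
   Context: A precubical object $X$ in $\mathscr{A}$ is a family of objects $(X_n)_{n\ge 0}$ with face morphisms $\partial_i^0,\partial_i^1: X_n\to X_{n-1}$ ($1\le i\le n$) satisfying $\partial_i^\alpha\partial_j^\varepsilon=\partial_{j-1}^\varepsilon\partial_i^\alpha$ for $i<j$, $\alpha,\varepsilon\in\{0,1\}$. A precubical morphism is a family of morphisms $f_n: X_n\to X_n'$ commuting with all faces. An augmented precubical object $X\xrightarrow{\partial}A$ is a precubical object $X$ with an object $A$ and a morphism $\partial: X_0\to A$ such that $\partial\partial_1^0=\partial\partial_1^1$. A morphism from $X\xrightarrow{\partial}A$ to $X'\xrightarrow{\partial'}A'$ is a precubical morphism $(f_n)$ together with $f: A\to A'$ such that $f\partial=\partial'f_0$. Given a class $\mathscr{P}$ of objects of $\mathscr{A}$, a morphism $f: B\to B'$ is $\mathscr{P}$-epimorphic if $\mathrm{Hom}_{\mathscr{A}}(Q,f)$ is surjective for all $Q\in\mathscr{P}$. $\mathscr{P}$ is a projective class if for each object $B$ there is a $\mathscr{P}$-epimorphic $e: Q\to B$ with $Q\in\mathscr{P}$. A cubical kernel of a sequence of morphisms $f_1^0,\dots,f_n^0,f_1^1,\dots,f_n^1: B\to C$ ($n\ge1$) is a sequence $k_1^0,\dots,k_{n+1}^0,k_1^1,\dots,k_{n+1}^1: K\to B$ with $f_i^\omega k_j^\alpha=f_{j-1}^\alpha k_i^\omega$ for $1\le i<j\le n+1$, $\omega,\alpha\in\{0,1\}$, which is universal: for any sequence $h_1^0,\dots,h_{n+1}^0,h_1^1,\dots,h_{n+1}^1: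 D\to B$ satisfying the same identities there is a unique $h: D\to K$ with $k_i^\omega h=h_i^\omega$ for all $i,\omega$. For an augmented precubical object $X\xrightarrow{\partial}A$, let $k_1^0,k_1^1: K_1\to X_0$ be the kernel pair of $\partial: X_0\to A$ and, for $n\ge2$, let $k_1^0,\dots,k_n^0,k_1^1,\dots,k_n^1: K_n\to X_{n-1}$ be a cubical kernel of $(\partial_1^0,\dots,\partial_{n-1}^0,\partial_1^1,\dots,\partial_{n-1}^1)$, the faces $X_{n-1}\to X_{n-2}$. Let $e_n: X_n\to K_n$ ($n\ge1$) be the unique morphism with $k_i^\varepsilon e_n=\partial_i^\varepsilon$. Then $X\xrightarrow{\partial}A$ is $\mathscr{P}$-projective if every $X_n\in\mathscr{P}$ ($n\ge0$), and $\mathscr{P}$-exact if $\partial$ and all $e_n$ ($n\ge1$) are $\mathscr{P}$-epimorphic. *)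

(* Defs.v *)
From mathcomp Require Import all_boot.

Set Implicit Arguments.
Unset Strict Implicit.
Unset Printing Implicit Defensive.

(** * Categories *)

Record category : Type := Category {
  obj :> Type;
  hom : obj -> obj -> Type;
  idm : forall a, hom a a;
  comp : forall a b c, hom b c -> hom a b -> hom a c;
  compA : forall a b c d (h : hom c d) (g : hom b c) (f : hom a b),
    comp h (comp g f) = comp (comp h g) f;
  comp1m : forall a b (f : hom a b), comp (idm b) f = f;
  compm1 : forall a b (f : hom a b), comp f (idm a) = f
}.

Arguments hom {A} a b : rename.
Arguments idm {A} a : rename.
Arguments comp {A a b c} g f : rename.

Declare Scope cat_scope.
Delimit Scope cat_scope with cat.
Notation "g \c f" := (comp g f) (at level 40, left associativity) : cat_scope.
Local Open Scope cat_scope.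

Record functor (J A : category) : Type := Functor {
  fobj :> J -> A;
  fmap : forall a b, hom a b -> hom (fobj a) (fobj b);
  fmap_id : forall a, fmap (idm a) = idm (fobj a);
  fmap_comp : forall a b c (g : hom b c) (f : hom a b),
    fmap (g \c f) = fmap g \c fmap f
}.

Definition is_cone (J A : category) (F : functor J A) (L : A)
    (p : forall j, hom L (F j)) : Prop :=
  forall (i j : J) (u : hom i j), fmap F u \c p i = p j.

Definition is_limit (J A : category) (F : functor J A) (L : A)
    (p : forall j, hom L (F j)) : Prop :=
  is_cone p /\
  forall (D : A) (q : forall j, hom D (F j)), is_cone q ->
    exists! h : hom D L, forall j, p j \c h = q j.

Definition finite_type (T : Type) : Prop :=
  exists (n : nat) (e : 'I_n -> T), bijective e.

Definition finite_category (J : category) : Prop :=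
  finite_type J /\ forall i j : J, finite_type (hom i j).

Definition has_finite_limits (A : category) : Prop :=
  forall J : category, finite_category J ->
  forall F : functor J A,
    exists (L : A) (p : forall j, hom L (F j)), is_limit p.

(** * Projective classes *)

Definition P_epimorphic (A : category) (P : A -> Prop) (B B' : A)
    (f : hom B B') : Prop :=
  forall Q : A, P Q -> forall g : hom Q B', exists h : hom Q B, f \c h = g.

Definition projective_class (A : category) (P : A -> Prop) : Prop :=
  forall B : A, exists (Q : A) (e : hom Q B), P Q /\ P_epimorphic P e.

(** * Precubical objects

   Face indices are shifted down by one: the faces [X_{n+1} -> X_n] are
   [d n w i] with [i : 'I_n.+1], standing for the face with lower index [i + 1]
   and upper index 0 if [w = false], 1 if [w = true]. *)

Definition osucc (n : nat) (i : 'I_n) : 'I_n.+1 := lift ord0 i.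
Definition owiden (n : nat) (i : 'I_n) : 'I_n.+1 := widen_ord (leqnSn n) i.

(* A pair of lower indices [i < j] is written [owiden i], [osucc j] with
   [i <= j]; then [j - 1] becomes [j]. *)
Record precubical (A : category) : Type := Precubical {
  cells :> nat -> A;
  d : forall n, bool -> 'I_n.+1 -> hom (cells n.+1) (cells n);
  dd : forall n (a w : bool) (i j : 'I_n.+1), i <= j ->
    d a i \c d w (osucc j) = d w j \c d a (owiden i)
}.

Record precubical_hom (A : category) (X X' : precubical A) : Type :=
  PrecubicalHom {
  phom :> forall n, hom (X n) (X' n);
  phom_d : forall n (w : bool) (i : 'I_n.+1),
    phom n \c d X w i = d X' w i \c phom n.+1
}.

Record augmented (A : category) : Type := Augmented {
  base :> precubical A;
  target : A;
  aug : hom (base 0) target;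
  aug_d : aug \c d base false ord0 = aug \c d base true ord0
}.

Definition is_augmented_hom (A : category) (X X' : augmented A)
    (fbar : precubical_hom X X') (f : hom (target X) (target X')) : Prop :=
  f \c aug X = aug X' \c fbar 0.

(** * Kernel pairs and cubical kernels *)

Definition is_kernel_pair (A : category) (B C : A) (f : hom B C) (K : A)
    (k : bool -> hom K B) : Prop :=
  f \c k false = f \c k true /\
  forall (D : A) (h : bool -> hom D B), f \c h false = f \c h true ->
    exists! u : hom D K, forall w, k w \c u = h w.

Definition cubical_ids (A : category) (n : nat) (B C : A)
    (f : bool -> 'I_n.+1 -> hom B C) (K : A)
    (k : bool -> 'I_n.+2 -> hom K B) : Prop :=
  forall (w a : bool) (i j : 'I_n.+1), i <= j ->
    f w i \c k a (osucc j) = f a j \c k w (owiden i).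

Definition is_cubical_kernel (A : category) (n : nat) (B C : A)
    (f : bool -> 'I_n.+1 -> hom B C) (K : A)
    (k : bool -> 'I_n.+2 -> hom K B) : Prop :=
  cubical_ids f k /\
  forall (D : A) (h : bool -> 'I_n.+2 -> hom D B), cubical_ids f h ->
    exists! u : hom D K, forall w i, k w i \c u = h w i.

(** * Projective and exact augmented precubical objects *)

Definition P_projective (A : category) (P : A -> Prop) (X : precubical A) :
    Prop :=
  forall n, P (X n).

(* Kernel pairs and cubical kernels are unique up to isomorphism, so it does not
   matter which ones are used; by [kernel_pair_exists] and
   [cubical_kernel_exists] below there are some when finite limits exist. *)
Definition P_exact (A : category) (P : A -> Prop) (X : augmented A) : Prop :=
  [/\ P_epimorphic P (aug X),
      forall (K : A) (k : bool -> hom K (X 0)), is_kernel_pair (aug X) k ->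
        forall e : hom (X 1) K, (forall w, k w \c e = d X w ord0) ->
        P_epimorphic P e
    & forall (n : nat) (K : A) (k : bool -> 'I_n.+2 -> hom K (X n.+1)),
        is_cubical_kernel (@d A X n) k ->
        forall e : hom (X n.+2) K, (forall w i, k w i \c e = d X w i) ->
        P_epimorphic P e].

Definition precubically_homotopic (A : category) (X X' : precubical A)
    (f g : precubical_hom X X') : Prop :=
  exists h : forall n, hom (X n) (X' n.+1),
    [/\ forall n, d X' false ord0 \c h n = f n,
        forall n, d X' true ord0 \c h n = g n
      & forall n (w : bool) (i : 'I_n.+1),
          d X' w (osucc i) \c h n.+1 = h n \c d X w i].

(** * Existence of kernel pairs and cubical kernels

   Both are limits over the category [fork] whose objects are [U + V], with
   two arrows [src v true -> v] and [src v false -> v] for each [v] in [V],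
   besides identities. *)

Definition fork_hom (U V : finType) (src : V -> bool -> U) (x y : U + V) :
    finType :=
  match x, y with
  | inl u, inl u' => {_ : unit | u == u'}
  | inl u, inr v => {b : bool | src v b == u}
  | inr _, inl _ => void
  | inr v, inr v' => {_ : unit | v == v'}
  end.

Definition fork_id (U V : finType) (src : V -> bool -> U) (x : U + V) :
    fork_hom src x x :=
  match x with
  | inl u => exist _ tt (eqxx u)
  | inr v => exist _ tt (eqxx v)
  end.

Definition fork_comp (U V : finType) (src : V -> bool -> U) (x y z : U + V) :
  fork_hom src y z -> fork_hom src x y -> fork_hom src x z.
Proof.
case: x y z => [u|v] [u'|v'] [u''|v''] //= g f.
- by exists tt; rewrite (eqP (valP f)); exact: (valP g).
- by exists (val g); rewrite (eqP (valP f)); exact: (valP g).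
- by exists (val f); rewrite -(eqP (valP g)); exact: (valP f).
- by exists tt; rewrite (eqP (valP f)); exact: (valP g).
Defined.

Lemma fork_compA (U V : finType) (src : V -> bool -> U) (a b c e : U + V)
    (h : fork_hom src c e) (g : fork_hom src b c) (f : fork_hom src a b) :
  fork_comp h (fork_comp g f) = fork_comp (fork_comp h g) f.
Proof.
by move: a b c e h g f => [a|a] [b|b] [c|c] [e|e] //= h g f; exact: val_inj.
Qed.

Lemma fork_comp1m (U V : finType) (src : V -> bool -> U) (a b : U + V)
    (f : fork_hom src a b) : fork_comp (fork_id src b) f = f.
Proof.
by move: a b f => [a|a] [b|b] //= f; apply: val_inj => //=; case: (val f).
Qed.

Lemma fork_compm1 (U V : finType) (src : V -> bool -> U) (a b : U + V)
    (f : fork_hom src a b) : fork_comp f (fork_id src a) = f.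
Proof.
by move: a b f => [a|a] [b|b] //= f; apply: val_inj => //=; case: (val f).
Qed.

Definition fork (U V : finType) (src : V -> bool -> U) : category :=
  Category (@fork_compA U V src) (@fork_comp1m U V src) (@fork_compm1 U V src).

Lemma finite_finType (T : finType) : finite_type T.
Proof. by exists #|T|, enum_val; exact: enum_val_bij. Qed.

Lemma fork_finite (U V : finType) (src : V -> bool -> U) :
  finite_category (fork src).
Proof.
by split=> [|i j]; [exact: (finite_finType (U + V)%type) | exact: finite_finType].
Qed.

Definition fork_obj (A : category) (U V : finType) (B C : A) (x : U + V) : A :=
  match x with inl _ => B | inr _ => C end.

Definition fork_map (A : category) (U V : finType) (src : V -> bool -> U)
    (B C : A) (m : V -> bool -> hom B C) (x y : U + V) :
    fork_hom src x y -> hom (fork_obj B C x) (fork_obj B C y) :=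
  match x, y with
  | inl _, inl _ => fun=> idm B
  | inl _, inr v => fun b => m v (val b)
  | inr _, inl _ => fun b => match b with end
  | inr _, inr _ => fun=> idm C
  end.

Lemma fork_map_id (A : category) (U V : finType) (src : V -> bool -> U)
    (B C : A) (m : V -> bool -> hom B C) (x : fork src) :
  fork_map m (idm x) = idm (fork_obj B C x).
Proof. by case: x. Qed.

Lemma fork_map_comp (A : category) (U V : finType) (src : V -> bool -> U)
    (B C : A) (m : V -> bool -> hom B C) (x y z : fork src)
    (g : hom y z) (f : hom x y) :
  fork_map m (g \c f) = fork_map m g \c fork_map m f.
Proof.
move: x y z g f => [x|x] [y|y] [z|z] //= g f; rewrite ?comp1m ?compm1 //=.
by congr (m _ _); exact: esym (eqP (valP g)).
Qed.

Definition fork_functor (A : category) (U V : finType) (src : V -> bool -> U)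
    (B C : A) (m : V -> bool -> hom B C) : functor (fork src) A :=
  Functor (fork_map_id m) (fork_map_comp m).

Lemma fork_limit (A : category) (U V : finType) (src : V -> bool -> U)
    (B C : A) (m : V -> bool -> hom B C) :
  has_finite_limits A ->
  exists (K : A) (k : U -> hom K B),
    (forall v, m v false \c k (src v false) = m v true \c k (src v true)) /\
    forall (D : A) (h : U -> hom D B),
      (forall v, m v false \c h (src v false) = m v true \c h (src v true)) ->
      exists! w : hom D K, forall u, k u \c w = h u.
Proof.
move=> /(_ _ (fork_finite src) (fork_functor src m)) [K [p [pc pu]]].
have arr v b : m v b \c p (inl (src v b)) = p (inr v).
  exact: (pc (inl (src v b)) (inr v) (exist _ b (eqxx _))).
exists K, (fun u => p (inl u)); split=> [v|D h hh]; first by rewrite !arr.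
pose q (x : fork src) : hom D (fork_obj B C x) :=
  match x with inl u => h u | inr v => m v false \c h (src v false) end.
have qc : is_cone (F := fork_functor src m) q.
  move=> [u|v] [u'|v'] //= f; rewrite ?comp1m ?(eqP (valP f)) //.
  case: f => b /= /eqP <-; case: b => //; exact: esym (hh v').
have [w [wq wu]] := pu D q qc.
exists w; split=> [u|w' w'h]; first exact: wq (inl u).
apply: wu => -[u|v] /=; first exact: w'h.
by rewrite -(arr v false) -compA w'h.
Qed.

Lemma kernel_pair_exists (A : category) (B C : A) (f : hom B C) :
  has_finite_limits A ->
  exists (K : A) (k : bool -> hom K B), is_kernel_pair f k.
Proof.
move=> lim.
have [K [k [kc ku]]] :=
  fork_limit (U := bool) (V := unit) (fun=> id) (fun _ _ => f) lim.
exists K, k; split=> [|D h hh]; first exact: kc tt.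
exact: ku.
Qed.

Lemma cubical_kernel_exists (A : category) (n : nat) (B C : A)
    (f : bool -> 'I_n.+1 -> hom B C) :
  has_finite_limits A ->
  exists (K : A) (k : bool -> 'I_n.+2 -> hom K B), is_cubical_kernel f k.
Proof.
move=> lim.
pose V : finType := {t : bool * bool * ('I_n.+1 * 'I_n.+1) | t.2.1 <= t.2.2}.
pose src (v : V) (b : bool) : bool * 'I_n.+2 :=
  let: (w, a, (i, j)) := val v in if b then (w, owiden i) else (a, osucc j).
pose m (v : V) (b : bool) : hom B C :=
  let: (w, a, (i, j)) := val v in if b then f a j else f w i.
have idsP D (h : bool -> 'I_n.+2 -> hom D B) :
  cubical_ids f h <-> forall v, m v false \c h (src v false).1 (src v false).2
                              = m v true \c h (src v true).1 (src v true).2.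
  split=> [hh [[[w a] [i j]] /= ij]|hh w a i j ij]; first exact: hh.
  exact: (hh (exist _ (w, a, (i, j)) ij)).
have [K [k [kc ku]]] := fork_limit src m lim.
exists K, (fun w i => k (w, i)); split=> [|D h /idsP hh].
  by apply/idsP => v; have:= kc v; do 2!case: (src v _).
have [u [uh uu]] := ku D (fun x => h x.1 x.2) hh.
exists u; split=> [w i|u' u'h]; first exact: uh (w, i).
by apply: uu => -[w i]; exact: u'h.
Qed.

(* Main.v *)
Require Import Defs.
From mathcomp Require Import all_boot.
From Stdlib Require Import IndefiniteDescription.

(** A family of maps from an object of [P] to [X' n] satisfying the identities of
the faces of an [n.+1]-cube factors through the cubical kernel, hence, by
exactness of [X'], through the faces of [X' n.+1].  An extension of [f] is built
by filling the boundaries [f_n \c d]; a homotopy is built by filling the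
boundaries whose two first faces are [f_n] and [g_n] and whose other faces are
given by the homotopy one dimension below. *)

Set Implicit Arguments.
Unset Strict Implicit.
Unset Printing Implicit Defensive.

Local Open Scope cat_scope.

(** Only elements satisfying the invariant [G] need have a successor, so the recursion runs on pairs
    of an element and a proof of [G]. *)
Lemma dependent_choice_nat (T : nat -> Type) (G : forall n, T n -> Prop)
    (R : forall n, T n -> T n.+1 -> Prop) (x0 : T 0) :
  G 0 x0 -> (forall n x, G n x -> exists y, R n x y /\ G n.+1 y) ->
  exists x : forall n, T n,
    [/\ x 0 = x0, forall n, G n (x n) & forall n, R n (x n) (x n.+1)].
Proof.
move=> Gx0 GR.
pose next n (s : {x : T n | G n x}) :=
  constructive_indefinite_description _ (GR n (sval s) (svalP s)).
pose chain := fix chain n : {x : T n | G n x} :=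
  if n is m.+1
  then exist (@G m.+1) (sval (next m (chain m))) (svalP (next m (chain m))).2
  else exist (@G 0) x0 Gx0.
exists (fun n => sval (chain n)); split=> // n; first exact: svalP (chain n).
exact: (svalP (next n (chain n))).1.
Qed.

Section Filling.
Variables (A : category) (P : A -> Prop) (X' : augmented A).

(** In degree 0 the augmentation stands in for the missing faces, matching the kernel pair with
    which exactness starts. *)
Definition cube_boundary (Q : A) (n : nat) :
    (bool -> 'I_n.+1 -> hom Q (X' n)) -> Prop :=
  match n with
  | 0 => fun g => aug X' \c g false ord0 = aug X' \c g true ord0
  | m.+1 => fun g => cubical_ids (@d A X' m) g
  end.

Lemma cube_boundary_fill (Q : A) (n : nat)
    (g : bool -> 'I_n.+1 -> hom Q (X' n)) :
  has_finite_limits A -> P_exact P X' -> P Q -> cube_boundary g ->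
  exists h : hom Q (X' n.+1), forall w i, d X' w i \c h = g w i.
Proof.
move=> lim [_ ex1 ex2] PQ; case: n g => [|n] g bg.
  (* [P_exact] speaks of every kernel, so any one provided by finite limits will do. The faces of
     [X'] and the family [g] induce [e] and [u] into it, and [h] lifts [u] along [e]. *)
  have [K [k kK]] := kernel_pair_exists (aug X') lim.
  have [e [ke _]] := kK.2 _ (fun w => d X' w ord0) (aug_d X').
  have [u [ku _]] := kK.2 _ (fun w => g w ord0) bg.
  have [h eh] := ex1 K k kK e ke Q PQ u.
  by exists h => w i; rewrite (ord1 i) -ke -Defs.compA eh ku.
have [K [k kK]] := cubical_kernel_exists (@d A X' n) lim.
have [e [ke _]] := kK.2 _ (@d A X' n.+1) (@dd A X' n).
have [u [ku _]] := kK.2 _ g bg.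
have [h eh] := ex2 n K k kK e ke Q PQ u.
by exists h => w i; rewrite -ke -Defs.compA eh ku.
Qed.

End Filling.

Section Comparison.
Variables (A : category) (P : A -> Prop) (X X' : augmented A).
Hypotheses (lim : has_finite_limits A) (projX : P_projective P X).
Hypothesis (exX' : P_exact P X').

Lemma precubical_extension_exists (f : hom (target X) (target X')) :
  exists fbar : precubical_hom X X', is_augmented_hom fbar f.
Proof.
have [u0 augu0] : exists u0, aug X' \c u0 = f \c aug X.
  by case: exX' => epi _ _; exact: epi (projX 0) _.
pose faces n (u : hom (X n) (X' n)) (w : bool) (i : 'I_n.+1) := u \c d X w i.
pose G n (u : hom (X n) (X' n)) := cube_boundary (faces n u).
pose R n (u : hom (X n) (X' n)) (v : hom (X n.+1) (X' n.+1)) :=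
  forall w i, d X' w i \c v = faces n u w i.
have G0 : G 0 u0 by rewrite /G /= /faces !Defs.compA augu0 -!Defs.compA aug_d.
(* Through [R], the identities for [v \c d] turn into those of [X] composed with [u]. *)
have GR n u : G n u -> exists v, R n u v /\ G n.+1 v.
  move=> /(cube_boundary_fill lim exX' (projX _)) [v uv].
  exists v; split=> // w a i j ij.
  by rewrite /faces !Defs.compA !uv /faces -!Defs.compA dd.
have [u [u0E _ uR]] := dependent_choice_nat G0 GR.
have uC n w i : u n \c d X w i = d X' w i \c u n.+1 by rewrite uR.
by exists (PrecubicalHom uC); rewrite /is_augmented_hom /= u0E augu0.
Qed.

Lemma owiden0 n : owiden (ord0 : 'I_n.+1) = ord0.
Proof. exact: val_inj. Qed.

Lemma owiden_osucc n (i : 'I_n.+1) : owiden (osucc i) = osucc (owiden i).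
Proof. exact: val_inj. Qed.

Lemma precubical_extension_homotopic (f : hom (target X) (target X'))
    (fbar gbar : precubical_hom X X') :
  is_augmented_hom fbar f -> is_augmented_hom gbar f ->
  precubically_homotopic fbar gbar.
Proof.
move=> augf augg.
pose ends (w : bool) := if w then gbar else fbar.
pose R n (h : hom (X n) (X' n.+1)) (h' : hom (X n.+1) (X' n.+2)) :=
  forall w i, d X' w (osucc i) \c h' = h \c d X w i.
(* The invariant also remembers a predecessor [h'] of [h]: the faces of [h] beyond the first pair
   must be known to check the next boundary. *)
pose G n (h : hom (X n) (X' n.+1)) := (forall w, d X' w ord0 \c h = ends w n) /\
  match n return hom (X n) (X' n.+1) -> Prop with
  | 0 => fun=> True
  | m.+1 => fun h => exists h', R m h' h
  end h.
have [h0 h0E] : exists h0, forall w i, d X' w i \c h0 = ends w 0.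
  (* The two ends form a boundary because both lie over [f]. *)
  apply: (cube_boundary_fill (g := fun w _ => ends w 0) lim exX' (projX 0)).
  by rewrite /= -augf -augg.
have G0 : G 0 h0 by split.
pose faces n (h : hom (X n) (X' n.+1)) (w : bool) (i : 'I_n.+2) :=
  if unlift ord0 i is Some j then h \c d X w j else ends w n.+1.
have faces0 n h w : faces n h w ord0 = ends w n.+1.
  by rewrite /faces unlift_none.
have facesS n h w i : faces n h w (osucc i) = h \c d X w i.
  by rewrite /faces /osucc liftK.
have GR n h : G n h -> exists h', R n h h' /\ G n.+1 h'.
  move=> [hE hprev].
  have /(cube_boundary_fill lim exX' (projX _)) [h' hh'] :
      cube_boundary (faces n h).
    move=> w a i j; rewrite facesS Defs.compA.
    (* For [i = ord0] the identity says that [fbar] or [gbar] commutes with faces. Otherwise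
       [i <= j] forces [j] to be a successor too, and both sides become the predecessor [h1] after
       two faces of [X], equal by [dd]. *)
    case: (unliftP ord0 i) => [i'|] ->; last first.
      by move=> _; rewrite owiden0 faces0 hE phom_d.
    case: n h hE hprev i j i' => [|n] h hE hprev i j i'; first by case: i'.
    have [h1 h1R] := hprev.
    case: (unliftP ord0 j) => [j'|] -> // ij.
    rewrite -![lift ord0 _]/(osucc _) owiden_osucc facesS Defs.compA !h1R -!Defs.compA.
    by rewrite dd.
  have hR : R n h h' by move=> w i; rewrite hh' facesS.
  exists h'; split=> //; split; last by exists h.
  by move=> w; rewrite hh' faces0.
have [h [_ hG hR]] := dependent_choice_nat G0 GR.
by exists h; split=> n; [exact: (hG n).1 false | exact: (hG n).1 true | exact: hR].
Qed.

End Comparison.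

Theorem theorem3p3 (A : category) (P : A -> Prop) (X X' : augmented A) :
  has_finite_limits A -> projective_class P ->
  P_projective P X -> P_exact P X' ->
  forall f : hom (target X) (target X'),
    (exists fbar : precubical_hom X X', is_augmented_hom fbar f) /\
    (forall fbar gbar : precubical_hom X X',
       is_augmented_hom fbar f -> is_augmented_hom gbar f ->
       precubically_homotopic fbar gbar).
Proof.
move=> lim _ projX exX' f; split.
  exact: (precubical_extension_exists lim projX exX').
exact: (precubical_extension_homotopic lim projX exX').
Qed.
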